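(* Let $\beta_0,\beta_1\in(1/2,1)$ with $\beta_0\ge\beta_1$ and let $I=[0,\beta_1/(1-\beta_1)]$. Then: (1) If $\beta_0(1+\beta_1)<1$, there are at least countably infinitely many $x\in I$ which have a unique $(\beta_0,\beta_1)$-expansion. (2) If $\beta_0(1+2\beta_1-\beta_0\beta_1)<1$, there are uncountably many $x\in I$ which have a unique $(\beta_0,\beta_1)$-expansion; moreover, the set of these $x$ has positive Hausdorff dimension.
   Context: Let $\Sigma=\{0,1\}^{\mathbb{N}}$ be the set of sequences $s=(s_i)_{i\ge1}$ of zeros and ones. For $s\in\Sigma$ and $n\ge1$, let $0_n(s)$ be the number of zeros and $1_n(s)$ the number of ones among $s_1,\dots,s_n$. For $\beta_0,\beta_1\in(1/2,1)$ with $\beta_0\ge\beta_1$ and $I=[0,\beta_1/(1-\beta_1)]$, define $\pi_{\beta_0,\beta_1}:\Sigma\to I$ by $$\pi_{\beta_0,\beta_1}(s)=\sum_{i=1}^{\infty}s_i\,\beta_0^{0_i(s)}\beta_1^{1_i(s)}.$$ A sequence $s\in\Sigma$ with $\pi_{\beta_0,\beta_1}(s)=x$ is called a $(\beta_0,\beta_1)$-expansion of $x\in I$. The number $x$ has a unique $(\beta_0,\beta_1)$-expansion if there is exactly one such $s$. *)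

(* Defs.v *)
From HB Require Import structures.
From mathcomp Require Import all_boot all_order all_algebra.
From mathcomp Require Import all_classical all_reals all_analysis.
Import Order.TTheory GRing.Theory Num.Theory.
Import numFieldNormedType.Exports.

Set Implicit Arguments.
Unset Strict Implicit.
Unset Printing Implicit Defensive.

Local Open Scope classical_set_scope.
Local Open Scope ring_scope.

(* Indices are shifted by one: [s k] is the digit s_(k+1), and true is the
   digit 1. *)
Definition digits : Type := nat -> bool.

(* The number of zeros (resp. ones) among the first n digits s_1, ..., s_n. *)
Definition zeros (s : digits) (n : nat) : nat := (\sum_(i < n) ~~ s i)%N.
Definition ones (s : digits) (n : nat) : nat := (\sum_(i < n) s i)%N.

Section expansions.
Context {R : realType}.

Definition expansion_term (b0 b1 : R) (s : digits) (k : nat) : R :=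
  (s k)%:R * b0 ^+ zeros s k.+1 * b1 ^+ ones s k.+1.

(* [limn] is total; the series converges whenever b0 and b1 are in ]0, 1[. *)
Definition expansion_value (b0 b1 : R) (s : digits) : R :=
  limn (series (expansion_term b0 b1 s)).

Definition is_expansion (b0 b1 x : R) (s : digits) : Prop :=
  expansion_value b0 b1 s = x.

Definition unique_expansion_set (b0 b1 : R) : set R :=
  [set x | x \in `[0, b1 / (1 - b1)] /\ exists! s, is_expansion b0 b1 x s].

End expansions.

Section hausdorff.
Context {R : realType}.
Implicit Types (A U : set R) (s d : R).
Local Open Scope ereal_scope.

(* The point 0 is added so that the empty set has diameter 0, not -oo. *)
Definition diameter A : \bar R :=
  ereal_sup (0 |` [set `|x - y|%R%:E | x in A & y in A]).

(* |U|^s, where the empty set counts for 0 even when s = 0. *)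
Definition diameter_pow s U : \bar R :=
  if U == set0 then 0 else diameter U `^ s.

Definition delta_cover d A : set ((set R)^nat) :=
  [set U | A `<=` \bigcup_k U k /\ forall k, diameter (U k) <= d%:E].

Definition hausdorff_premeasure s d A : \bar R :=
  ereal_inf [set \sum_(0 <= k <oo) diameter_pow s (U k) | U in delta_cover d A].

Definition hausdorff_measure s A : \bar R :=
  ereal_sup [set hausdorff_premeasure s d A | d in [set d | (0 < d)%R]].

Definition hausdorff_dim A : \bar R :=
  ereal_inf [set s%:E | s in [set s | (0 <= s)%R /\ hausdorff_measure s A = 0]].

End hausdorff.

(* Main.v *)
(* Prepending a digit acts on values by the contractions y |-> b0 y (digit 0)
   and y |-> b1 (1 + y) (digit 1), whose images of I overlap only in
   [b1, b0 b1 / (1 - b1)].  So a sequence is the unique expansion of its value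
   as soon as the values of all its tails avoid this overlap.  For (1), the
   sequences 0^n (01)^oo qualify.  For (2), so do all sequences of blocks 0101
   and 0011.  Both blocks contract by q = (b0 b1)^2 and their images are at
   distance at least q, so that sequences of blocks which first differ in the
   n-th block have values at distance at least q^n.  Since q > 1/16, coding the
   blocks by binary digits gives a map from [0, 1[ whose inverse is Hoelder of
   every exponent s <= 1/4, and comparison with Lebesgue measure yields
   dimension at least 1/4. *)
Require Import Defs.
From HB Require Import structures.
From mathcomp Require Import all_boot all_order all_algebra.
From mathcomp Require Import all_classical all_reals all_analysis.
From mathcomp Require Import ring lra.
Import Order.TTheory GRing.Theory Num.Theory.
Import numFieldNormedType.Exports.
Local Open Scope classical_set_scope.
Local Open Scope ring_scope.

Set Implicit Arguments.
Unset Strict Implicit.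
Unset Printing Implicit Defensive.

(** * Tails of digit sequences, the recursion for values, and a criterion for uniqueness *)

Definition tl (s : digits) : digits := fun n => s n.+1.

Lemma zerosS s n : zeros s n.+1 = (~~ s 0 + zeros (tl s) n)%N.
Proof. by rewrite /zeros big_ord_recl. Qed.

Lemma onesS s n : ones s n.+1 = (s 0 + ones (tl s) n)%N.
Proof. by rewrite /ones big_ord_recl. Qed.

Section ExpansionValue.
Variables (R : realType) (b0 b1 : R).
Hypotheses (b0_gt0 : 0 < b0) (b0_lt1 : b0 < 1) (b1_gt0 : 0 < b1)
  (b10 : b1 <= b0).

Let b1_lt1 : b1 < 1. Proof. exact: le_lt_trans b10 b0_lt1. Qed.

Local Notation M := (b1 / (1 - b1)).
Local Notation ev := (expansion_value b0 b1).
Local Notation S s := (series (expansion_term b0 b1 s)).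

Let ME : M = b1 * (1 + M).
Proof. by field; rewrite subr_eq0 gt_eqF. Qed.

Let M_gt0 : 0 < M. Proof. by rewrite divr_gt0 ?subr_gt0. Qed.

Lemma expansion_termS s k :
  expansion_term b0 b1 s k.+1 =
  (if s 0%N then b1 else b0) * expansion_term b0 b1 (tl s) k.
Proof.
rewrite /expansion_term zerosS onesS -/(tl s k).
by case: (s 0%N); rewrite /= ?add0n !add1n !exprS; ring.
Qed.

Lemma expansion_series_recl s n :
  S s n.+1 = if s 0%N then b1 * (1 + S (tl s) n) else b0 * S (tl s) n.
Proof.
rewrite /series /= big_nat_recl //.
under eq_bigr do rewrite expansion_termS.
rewrite -big_distrr /= /expansion_term zerosS onesS /zeros /ones !big_ord0.
by case: (s 0%N); rewrite /= !addn0 expr0 expr1; ring.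
Qed.

Lemma expansion_term_ge0 s k : 0 <= expansion_term b0 b1 s k.
Proof. by rewrite /expansion_term !mulr_ge0 ?exprn_ge0// ltW. Qed.

(** [M] is the fixed point of y |-> b1 (1 + y), and both digit maps send ]-oo, M] into itself. *)
Lemma expansion_series_le s n : S s n <= M.
Proof.
elim: n s => [|n IH] s; first by rewrite /series /= big_geq// ltW.
rewrite expansion_series_recl; case: (s 0%N).
  by rewrite [leRHS]ME ler_wpM2l ?(ltW b1_gt0)// lerD2l.
have [h|h] := leP 0 (S (tl s) n).
  by apply: le_trans (IH (tl s)); rewrite ler_piMl// (ltW b0_lt1).
by apply: (@le_trans _ _ 0); rewrite ?(ltW M_gt0)// ltW// pmulr_rlt0.
Qed.

Lemma is_cvg_expansion_series s : cvgn (S s).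
Proof.
apply: nondecreasing_is_cvgn.
  apply/nondecreasing_seqP => n.
  by rewrite /series /= big_nat_recr//= lerDl expansion_term_ge0.
by exists M => _ [n _ <-]; exact: expansion_series_le.
Qed.

Lemma expansion_value_recl s :
  ev s = if s 0%N then b1 * (1 + ev (tl s)) else b0 * ev (tl s).
Proof.
have /cvg_ex[l hl] : cvgn (S (tl s)) by exact: is_cvg_expansion_series.
have hl' : ev (tl s) = l by apply: cvg_lim.
rewrite hl'; apply: cvg_lim => //.
rewrite -(cvg_shiftS (S s)).
under eq_fun do rewrite expansion_series_recl.
case: (s 0%N); last exact: cvgMl_tmp.
by apply: cvgMl_tmp => //; apply: cvgD => //; exact: cvg_cst.
Qed.

Lemma expansion_value_ge0 s : 0 <= ev s.
Proof.
apply: limr_ge; first exact: is_cvg_expansion_series.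
by apply: nearW => n; rewrite sumr_ge0// => i _; exact: expansion_term_ge0.
Qed.

Lemma expansion_value_le s : ev s <= M.
Proof.
apply: limr_le; first exact: is_cvg_expansion_series.
by apply: nearW => n; exact: expansion_series_le.
Qed.

(** A first digit 0 forces a value at most b0 M, and a first digit 1 a value at least b1, so the
    second hypothesis fixes the first digit of any competing expansion. The digit maps are
    injective, so the tails have equal values again. *)
Lemma unique_expansion_of_stable (P : set digits) :
  (forall s, P s -> P (tl s)) ->
  (forall s, P s -> if s 0%N then b0 * M < ev s else ev s < b1) ->
  forall s, P s -> unique_expansion_set b0 b1 (ev s).
Proof.
move=> Ptl Phd s Ps; split.
  by rewrite in_itv/= expansion_value_ge0 expansion_value_le.
have hd t t' : P t -> ev t = ev t' -> t 0%N = t' 0%N.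
  move=> Pt e; have := Phd t Pt; rewrite e expansion_value_recl.
  have [e0 eM] := (expansion_value_ge0 (tl t'), expansion_value_le (tl t')).
  case: (t 0%N); case: (t' 0%N) => //.
    by rewrite ltNge ler_wpM2l// (ltW b0_gt0).
  by rewrite ltNge ler_peMr ?(ltW b1_gt0)// lerDl.
exists s; split=> // s' /esym e; rewrite /is_expansion in e.
apply/funext => n; elim: n s s' Ps e => [|n IH] t t' Pt e; first exact: hd.
apply: (IH (tl t) (tl t') (Ptl _ Pt)).
move: (e); rewrite [ev t]expansion_value_recl [ev t']expansion_value_recl.
rewrite (hd _ _ Pt e); case: (t' 0%N).
  by move=> /(mulfI (lt0r_neq0 b1_gt0)) /addrI.
by move=> /(mulfI (lt0r_neq0 b0_gt0)).
Qed.

End ExpansionValue.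

(** * Digit sequences for the two claims, and an inequality between the parameters *)

Definition alternating : digits := odd.

Fixpoint prefix_zeros (n : nat) (s : digits) : digits :=
  if n is m.+1 then fun k => if k is j.+1 then prefix_zeros m s j else false
  else s.

(** Each digit of [t] selects a block of four: 1 gives 0101 and 0 gives 0011. *)
Fixpoint weave (t : digits) (n : nat) : bool :=
  match n with
  | 0 => false
  | 1 => t 0%N
  | 2 => ~~ t 0%N
  | 3 => true
  | k.+4 => weave (tl t) k
  end.

Lemma weave1 t : tl (weave t) 0%N = t 0%N. Proof. by []. Qed.

Lemma weave2 t : tl (tl (weave t)) 0%N = ~~ t 0%N. Proof. by []. Qed.

Lemma weave3 t : tl (tl (tl (weave t))) 0%N = true. Proof. by []. Qed.

(** The fixed point of y |-> b0 b1 (1 + y). *)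
Definition alternating_value (R : realType) (b0 b1 : R) : R :=
  b0 * b1 / (1 - b0 * b1).

(** This puts b1 (1 + y) to the right of the overlap whenever y >= b0^2 b1 (1 + b1), a lower bound
    for the values of [weave]. *)
Lemma gap_upper_branch (R : realFieldType) (b0 b1 : R) :
  0 < b0 < 1 -> 0 < b1 <= b0 -> b0 * (1 + 2 * b1 - b0 * b1) < 1 ->
  b0 < (1 - b1) * (1 + b0 ^+ 2 * b1 * (1 + b1)).
Proof.
move=> /andP[b0_gt0 b0_lt1] /andP[b1_gt0 b10] gap.
have b01_gt0 : 0 < b0 * b1 by rewrite mulr_gt0.
(* For b0 >= 11/20 the hypothesis bounds b0 b1 by 9/29; below 11/20 the
   difference of the two sides is monotone in b0 and in b1. *)
have [h|h] := leP (11%:R / 20%:R) b0.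
  have b01_le : b0 * b1 <= 9%:R / 29%:R.
    have h2 : 0 < 2 - b0 by lra.
    by rewrite -(ler_pM2r h2); lra.
  have sq : (b0 * b1) * (b0 * b1) <= (9%:R / 29%:R) * (9%:R / 29%:R).
    by apply: ler_pM => //; exact: ltW.
  (* This product is the slack of the goal minus the slack of [gap]. *)
  have : 0 < b1 * (2 * b0 - 1 - (b0 * b1) * (b0 * b1)).
    by rewrite mulr_gt0//; lra.
  by lra.
pose B : R := 11%:R / 20%:R.
have b05 : b0 ^+ 5 <= B ^+ 5 by rewrite lerXn2r ?nnegrE /B//; lra.
have b03 : B ^+ 3 - b0 ^+ 3 <= B - b0.
  have -> : B ^+ 3 - b0 ^+ 3 = (B - b0) * (B ^+ 2 + B * b0 + b0 ^+ 2) by ring.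
  rewrite ler_piMr ?subr_ge0 ?(ltW h)//.
  have s1 : B * b0 <= B * B by rewrite ler_wpM2l /B//; lra.
  have s2 : b0 ^+ 2 <= B ^+ 2 by rewrite lerXn2r ?nnegrE /B//; lra.
  by move: s1 s2; rewrite /B; lra.
(* The slack of the goal at b1 = b0; the two products below add up to the change from there to the
   actual b1. *)
have diag : 0 < 1 - 2 * b0 + b0 ^+ 3 - b0 ^+ 5.
  by move: b05 b03; rewrite /B; lra.
have : 0 <= (b0 - b1) * (1 - b0 ^+ 2).
  by rewrite mulr_ge0 ?subr_ge0// exprn_ile1// ltW.
have : 0 <= b0 ^+ 2 * (b0 ^+ 3 - b1 ^+ 3).
  by rewrite mulr_ge0 ?exprn_ge0 ?subr_ge0 ?lerXn2r ?nnegrE// ltW.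
by lra.
Qed.

(** * Unique expansions from [alternating] and from [weave] *)

Section UniqueExpansions.
Variables (R : realType) (b0 b1 : R).
Hypotheses (b0_gt0 : 0 < b0) (b0_lt1 : b0 < 1) (b1_gt0 : 0 < b1)
  (b10 : b1 <= b0).

Let b1_lt1 : b1 < 1. Proof. exact: le_lt_trans b10 b0_lt1. Qed.
Let b01_gt0 : 0 < b0 * b1. Proof. exact: mulr_gt0. Qed.
Let b01_lt1 : b0 * b1 < 1.
Proof. by rewrite mulr_ilt1// ltW. Qed.

Local Notation ev := (expansion_value b0 b1).
Local Notation x := (alternating_value b0 b1).

Let evE s : ev s = if s 0%N then b1 * (1 + ev (tl s)) else b0 * ev (tl s).
Proof. exact: expansion_value_recl. Qed.

Let xE : x * (1 - b0 * b1) = b0 * b1.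
Proof. by rewrite divfK// subr_eq0 gt_eqF. Qed.

Let x_gt0 : 0 < x. Proof. by rewrite divr_gt0 ?subr_gt0. Qed.

Let x_lt_b1 : b0 * (1 + b1) < 1 -> x < b1.
Proof.
move=> h; rewrite /alternating_value mulrAC -[ltRHS]mul1r ltr_pM2r//.
by rewrite ltr_pdivrMr ?subr_gt0//; lra.
Qed.

Lemma expansion_value_alternating : ev alternating = x.
Proof.
have : ev alternating = b0 * (b1 * (1 + ev alternating)).
  have -> : b0 * (b1 * (1 + ev alternating)) =
      b0 * (b1 * (1 + ev (tl (tl alternating)))).
    by congr (_ * (_ * (_ + ev _))); apply/funext => n; rewrite /tl/= negbK.
  by rewrite [LHS]evE/= [ev (tl _)]evE.
move=> e; have dn0 : 1 - b0 * b1 != 0 by rewrite subr_eq0 gt_eqF.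
by apply: (mulIf dn0); rewrite xE mulrBr mulr1 {1}e; ring.
Qed.

Lemma expansion_value_prefix_zeros n s : ev (prefix_zeros n s) = b0 ^+ n * ev s.
Proof.
elim: n => [|n IH]; first by rewrite expr0 mul1r.
by rewrite evE/= exprS -mulrA -IH.
Qed.

Lemma unique_expansion_prefix_zeros n : b0 * (1 + b1) < 1 ->
  unique_expansion_set b0 b1 (b0 ^+ n * x).
Proof.
move=> h.
rewrite -expansion_value_alternating -expansion_value_prefix_zeros.
(* The tails of 0^n (01)^oo are the sequences 0^m (01)^oo and (10)^oo. *)
apply: (unique_expansion_of_stable b0_gt0 b0_lt1 b1_gt0 b10
  (P := [set s | s = tl alternating \/
                 exists m, s = prefix_zeros m alternating])); last first.
- by right; exists n.
- move=> _ [->|[m ->]] /=.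
    have yE : x = b0 * ev (tl alternating).
      by rewrite -expansion_value_alternating evE.
    rewrite -(ltr_pM2l b0_gt0) -yE mulrA ltr_pdivlMr ?subr_gt0//.
    rewrite mulrA mulrAC ltr_pdivrMr ?subr_gt0//.
    (* The slack of the goal factors in this way; the last factor is positive by [h] and b1 <=
       b0. *)
    have : 0 < b0 * b1 * (1 - b0) * (1 - b1 - b0 * b1).
      by rewrite !mulr_gt0// ?subr_gt0//; have := b10; lra.
    by lra.
  have -> : prefix_zeros m alternating 0%N = false by case: m.
  rewrite expansion_value_prefix_zeros expansion_value_alternating.
  apply: (@le_lt_trans _ _ x).
    by rewrite ler_piMl ?exprn_ile1// ltW.
  exact: x_lt_b1.
- move=> _ [->|[[|m] ->]].
  + by right; exists 0%N; apply/funext => k; rewrite /tl/= negbK.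
  + by left.
  + by right; exists m.
Qed.

Local Notation q := (b0 ^+ 2 * b1 ^+ 2).
Local Notation V t := (ev (weave t)).

Lemma expansion_value_weave t : V t =
  (if t 0%N then b0 * b1 else b0 ^+ 2 * b1) + q * (1 + V (tl t)).
Proof.
rewrite (_ : weave (tl t) = tl (tl (tl (tl (weave t)))))//.
rewrite evE [ev (tl _)]evE weave1 [ev (tl (tl _))]evE weave2.
rewrite [ev (tl (tl (tl _)))]evE weave3.
by case: (t 0%N) => /=; ring.
Qed.

Hypothesis gap : b0 * (1 + 2 * b1 - b0 * b1) < 1.

Let b01D : b0 * (1 + b1) < 1.
Proof.
have : 0 < b0 * b1 * (1 - b0) by rewrite mulr_gt0// subr_gt0.
by have := gap; lra.
Qed.

(* V t - x is at most q times its value at the tail of t, hence its supremum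
   over all t is at most 0. *)
Lemma expansion_value_weave_le t : V t <= x.
Proof.
pose f u := V u - x.
have fq u : f u <= q * f (tl u).
  rewrite /f expansion_value_weave.
  (* [x] is also fixed by the map of the block 0101, the one with the larger offset. *)
  have xq : x = b0 * b1 + q * (1 + x).
    have xc : x * (b0 * b1) = x - b0 * b1 by have := xE; lra.
    have -> : q * (1 + x) = b0 * b1 * (b0 * b1 + x * (b0 * b1)) by ring.
    by rewrite xc; lra.
  have : b0 ^+ 2 * b1 <= b0 * b1.
    by rewrite expr2 -mulrA ler_piMl// ltW.
  by case: (u 0%N); lra.
have supf : has_sup (range f).
  split; first by exists (f t); exists t.
  exists (b1 / (1 - b1)) => _ [u _ <-].
  apply: le_trans (expansion_value_le b0_gt0 b0_lt1 b1_gt0 b10 (weave u)).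
  by rewrite /f lerBlDr lerDl ltW.
have q0 : 0 <= q by rewrite mulr_ge0// exprn_ge0// ltW.
have q1 : q < 1 by rewrite -exprMn exprn_ilt1// ltW.
have s0 : sup (range f) <= q * sup (range f).
  apply: ge_sup => [|_ [u _ <-]]; first by exists (f t); exists t.
  apply: (le_trans (fq u)); rewrite ler_wpM2l//.
  by apply: sup_ubound; [exact: supf.2|exists (tl u)].
have : f t <= sup (range f) by apply: sup_ubound; [exact: supf.2|exists t].
rewrite /f => ft.
have : (1 - q) * sup (range f) <= 0 by lra.
rewrite pmulr_rle0 ?subr_gt0//; lra.
Qed.

Lemma expansion_value_weave_ge t : b0 ^+ 2 * b1 * (1 + b1) <= V t.
Proof.
have Vtl := expansion_value_ge0 b0_gt0 b0_lt1 b1_gt0 b10 (weave (tl t)).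
have qV : 0 <= q * V (tl t) by rewrite mulr_ge0// mulr_ge0// exprn_ge0// ltW.
rewrite expansion_value_weave; case: (t 0%N); last by lra.
have : 0 < b0 * b1 * (1 - b0 * (1 + b1)) by rewrite mulr_gt0// subr_gt0.
have : 0 <= q by rewrite mulr_ge0// exprn_ge0// ltW.
by lra.
Qed.

(** Clearing the denominator gives exactly the hypothesis [gap]. *)
Let x_lt : x < 1 - b0.
Proof.
by rewrite /alternating_value ltr_pdivrMr ?subr_gt0//; have := gap; lra.
Qed.

Let b0M_lt : b0 * (b1 / (1 - b1)) < b1 * (1 + b0 ^+ 2 * b1 * (1 + b1)).
Proof.
rewrite mulrA ltr_pdivrMr ?subr_gt0// [ltLHS]mulrC -[ltRHS]mulrA ltr_pM2l//.
rewrite [ltRHS]mulrC.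
by apply: gap_upper_branch gap; apply/andP.
Qed.

Lemma unique_expansion_weave t : unique_expansion_set b0 b1 (V t).
Proof.
apply: (unique_expansion_of_stable b0_gt0 b0_lt1 b1_gt0 b10
  (P := [set s | exists u, [\/ s = weave u, s = tl (weave u),
     s = tl (tl (weave u)) | s = tl (tl (tl (weave u)))]])); last first.
- by exists t; constructor 1.
- move=> s [u H].
  have Vle := expansion_value_weave_le (tl u).
  have Vge := expansion_value_weave_ge (tl u).
  have V3 : ev (tl (tl (tl (weave u)))) = b1 * (1 + V (tl u)) by rewrite evE.
  have V2 : ev (tl (tl (weave u))) =
      if u 0%N then b0 * (b1 * (1 + V (tl u)))
      else b1 * (1 + b1 * (1 + V (tl u))).
    by rewrite evE V3 weave2; case: (u 0%N).
  have V1 : ev (tl (weave u)) =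
      if u 0%N then b1 * (1 + b0 * (b1 * (1 + V (tl u))))
      else b0 * (b1 * (1 + b1 * (1 + V (tl u)))).
    by rewrite evE V2 weave1; case: (u 0%N).
  (* For tails starting with 1: it suffices to bound from below the value [y] of what follows this
     digit. *)
  have lt1 (y : R) : b0 ^+ 2 * b1 * (1 + b1) <= y ->
      b0 * (b1 / (1 - b1)) < b1 * (1 + y).
    move=> hy; apply: (lt_le_trans b0M_lt).
    by rewrite ler_wpM2l ?(ltW b1_gt0)// lerD2l.
  have V'_ge0 := expansion_value_ge0 b0_gt0 b0_lt1 b1_gt0 b10 (weave (tl u)).
  have ge2 : b0 ^+ 2 * b1 * (1 + b1) <= b0 * b1 * (1 + V (tl u)).
    have : 0 < b0 * b1 * (1 - b0 * (1 + b1)) by rewrite mulr_gt0// subr_gt0.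
    have : 0 <= b0 * b1 * V (tl u) by rewrite mulr_ge0// ltW.
    by lra.
  have ge3 : b0 * b1 * (1 + V (tl u)) <= b1 * (1 + V (tl u)).
    have V1_ge0 : 0 <= 1 + V (tl u) by rewrite addr_ge0.
    by rewrite -mulrA ler_piMl ?(ltW b0_lt1)// mulr_ge0// ltW.
  have lex : b0 * b1 * (1 + V (tl u)) <= x.
    have : b0 * b1 * (1 + V (tl u)) <= b0 * b1 * (1 + x).
      by rewrite ler_wpM2l ?(ltW b01_gt0)// lerD2l.
    by have := xE; lra.
  have le2 := le_lt_trans lex (x_lt_b1 b01D).
  case: H => ->.
  + exact: le_lt_trans (expansion_value_weave_le u) (x_lt_b1 b01D).
  + rewrite V1 weave1; case: (u 0%N).
      by apply: lt1; rewrite mulrA.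
    (* For the tail 011 of a block 0011 the claim becomes b0 + b0 b1 (1 + V (tl u)) < 1, which
       follows from [lex] and [x_lt]. *)
    rewrite mulrCA -[ltRHS]mulr1 ltr_pM2l//.
    by have := x_lt; lra.
  + rewrite V2 weave2; case: (u 0%N) => /=.
      by rewrite mulrA.
    by apply: lt1; apply: le_trans ge2 ge3.
  + rewrite V3 weave3.
    exact/lt1/expansion_value_weave_ge.
- move=> _ [u []->].
  + by exists u; constructor 2.
  + by exists u; constructor 3.
  + by exists u; constructor 4.
  + by exists (tl u); constructor 1.
Qed.

(** Each common block scales the difference by exactly q, and the first differing blocks leave at
    least q. *)
Lemma expansion_value_weave_separated n (t u : digits) :
  (forall i, (i < n)%N -> t i = u i) -> t n != u n ->
  q ^+ n.+1 <= `|V t - V u|.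
Proof.
have q0 : 0 < q by rewrite mulr_gt0// exprn_gt0.
elim: n t u => [|n IH] t u tu tun; last first.
  have -> : V t - V u = q * (V (tl t) - V (tl u)).
    rewrite [V t]expansion_value_weave [V u]expansion_value_weave (tu 0%N)//.
    by ring.
  rewrite exprS normrM (gtr0_norm q0) ler_pM2l//.
  by apply: IH => // i ni; exact: tu.
wlog [t0 u0] : t u tu tun / t 0%N = true /\ u 0%N = false.
  move=> W; case: (boolP (t 0%N)) => t0.
    apply: W => //; split=> //; apply/negbTE.
    by move: tun; rewrite t0; case: (u 0%N).
  rewrite distrC; apply: W => //; first by rewrite eq_sym.
  by move: tun; rewrite (negbTE t0); case: (u 0%N).
rewrite expr1 [V t]expansion_value_weave [V u]expansion_value_weave t0 u0.
apply: le_trans (ler_norm _).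
have Vt := expansion_value_ge0 b0_gt0 b0_lt1 b1_gt0 b10 (weave (tl t)).
have Vu := expansion_value_weave_le (tl u).
have : q * (V (tl u) - V (tl t)) <= q * (1 - b0).
  by rewrite ler_pM2l//; have := x_lt; lra.
(* The offsets differ by b0 b1 (1 - b0) and the tails take away at most q (1 - b0); what remains
   exceeds q by this product. *)
have : 0 < b0 * b1 * (1 - b0 * (1 + 2 * b1 - b0 * b1)).
  by rewrite mulr_gt0// subr_gt0.
lra.
Qed.

End UniqueExpansions.

(** * A lower bound for the Hausdorff dimension *)

Section HausdorffLowerBound.
Variable R : realType.
Local Open Scope ereal_scope.

Lemma diameter_ge0 (U : set R) : 0 <= diameter U.
Proof. by apply: ereal_sup_ubound; left. Qed.

Lemma le_diameter (U : set R) a b : U a -> U b -> `|a - b|%:E <= diameter U.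
Proof.
by move=> Ua Ub; apply: ereal_sup_ubound; right; exists a => //; exists b.
Qed.

Lemma diameter_pow_ge0 s (U : set R) : 0 <= diameter_pow s U.
Proof. by rewrite /diameter_pow; case: ifP => // _; exact: poweR_ge0. Qed.

(* The inverse of f is Hoelder, hence shrinks f(U) to a set of length at most
   twice C |U|^s, and these lengths have to add up to at least 1. *)
Lemma hausdorff_premeasure_ge (A : set R) (f : R -> R) (C s : R) :
  (0 < C)%R -> (0 <= s)%R ->
  (forall u, (0 <= u < 1)%R -> A (f u)) ->
  (forall u v, (0 <= u < 1)%R -> (0 <= v < 1)%R ->
     (`|u - v| <= C * `|f u - f v| `^ s)%R) ->
  ((2 * C)^-1)%:E <= hausdorff_premeasure s 1 A.
Proof.
move=> C0 s0 fA fC; apply: le_ereal_inf_tmp => _ [U [AU diamU] <-].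
have cov (k : nat) : exists Bk : set R, [/\ measurable Bk,
     lebesgue_measure Bk <= (2 * C)%:E * diameter_pow s (U k) &
     forall u, (0 <= u < 1)%R -> U k (f u) -> Bk u].
  have [[a [a01 Ua]]|none] :=
    pselect (exists a, (0 <= a < 1)%R /\ U k (f a)); last first.
    exists set0; split => //.
      by rewrite measure0 mule_ge0 ?diameter_pow_ge0// lee_fin mulr_ge0// ltW.
    by move=> u u01 Uu; apply: none; exists u.
  have Uk0 : U k == set0 = false.
    by apply/negbTE/set0P; exists (f a).
  have [D diamE] : exists D : R, diameter (U k) = D%:E.
    exists (fine (diameter (U k))); rewrite fineK// ge0_fin_numE ?diameter_ge0//.
    by apply: le_lt_trans (diamU k) _; rewrite ltry.
  pose r := (C * D `^ s)%R.
  have r0 : (0 <= r)%R by rewrite mulr_ge0 ?powR_ge0// ltW.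
  (* By [fC], every [u] with [f u] in [U k] lies within [r] of [a]. *)
  exists `[(a - r)%R, (a + r)%R]%classic; split => //.
    rewrite lebesgue_measure_itv /diameter_pow Uk0 diamE poweR_EFin /=.
    rewrite -EFinM -mulrA -/r; case: ifPn => _.
      by rewrite -EFinB lee_fin; lra.
    by rewrite lee_fin mulr_ge0.
  move=> u u01 Uu; rewrite /= in_itv/= -ler_distl.
  apply: le_trans (fC u a u01 a01) _.
  rewrite ler_wpM2l ?(ltW C0)// ge0_ler_powR// ?nnegrE//.
    by rewrite -lee_fin -diamE; apply: le_trans (diameter_ge0 (U k)) _.
  by rewrite -lee_fin -diamE; exact: le_diameter.
have [B BP] := choice cov.
have le1 : 1 <= \sum_(0 <= k <oo) lebesgue_measure (B k).
  have <- : lebesgue_measure `[0%R, 1%R[%classic = 1 :> \bar R.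
    by rewrite lebesgue_measure_itv/= lte_fin ltr01 sube0.
  apply: measure_sigma_subadditive => [k|//|u /=].
    by have [] := BP k.
  rewrite in_itv/= => u01; have [k _ Uk] := AU _ (fA u u01).
  by exists k => //; have [_ _] := BP k; exact.
rewrite -[leLHS]mule1 lee_pdivrMl ?mulr_gt0//.
rewrite -nneseriesZl => [|k _]; last exact: diameter_pow_ge0.
by apply: le_trans le1 _; apply: lee_nneseries => // k _; have [] := BP k.
Qed.

(** For every s < s0 the measure is at least the premeasure at scale 1, which is positive. Assuming
    the estimate for all exponents up to [s0] avoids comparing measures of different exponents. *)
Lemma hausdorff_dim_ge (A : set R) (f : R -> R) (C s0 : R) :
  (0 < C)%R ->
  (forall u, (0 <= u < 1)%R -> A (f u)) ->
  (forall s u v, (0 <= s <= s0)%R -> (0 <= u < 1)%R -> (0 <= v < 1)%R ->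
     (`|u - v| <= C * `|f u - f v| `^ s)%R) ->
  s0%:E <= hausdorff_dim A.
Proof.
move=> C0 fA fC; apply: le_ereal_inf_tmp => _ [s [s_ge0 Hs] <-].
rewrite lee_fin leNgt; apply/negP => ss0.
suff : 0 < hausdorff_measure s A by rewrite Hs ltxx.
apply: (@lt_le_trans _ _ ((2 * C)^-1)%:E).
  by rewrite lte_fin invr_gt0 mulr_gt0.
apply: le_trans (hausdorff_premeasure_ge C0 s_ge0 fA _) _.
  by move=> u v; apply: fC; rewrite s_ge0 ltW.
by apply: ereal_sup_ubound; exists 1%R => /=.
Qed.

End HausdorffLowerBound.

(** * Binary digits in [0, 1[ through the doubling map *)

Section BinaryDigits.
Variable R : realType.
Implicit Types u v : R.

Definition doubling u : R := if u < 2^-1 then 2 * u else 2 * u - 1.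

Definition binary u : digits := fun n => 2^-1 <= iter n doubling u.

Lemma doubling_itv u : 0 <= u < 1 -> 0 <= doubling u < 1.
Proof. by rewrite /doubling => u01; case: ltP => ?; lra. Qed.

Lemma tl_binary u : tl (binary u) = binary (doubling u).
Proof. by apply/funext => n; rewrite /tl /binary iterSr. Qed.

(** Equal digits keep both orbits on the same branch of [doubling], where distances double, yet they
    stay at most 1. *)
Lemma binary_dist n u v : 0 <= u < 1 -> 0 <= v < 1 ->
  (forall i, (i < n)%N -> binary u i = binary v i) -> `|u - v| <= 2^-1 ^+ n.
Proof.
elim: n u v => [|n IH] u v u01 v01 uv.
  by rewrite expr0 ler_norml; lra.
have : `|doubling u - doubling v| <= 2^-1 ^+ n.
  apply: IH; [exact: doubling_itv|exact: doubling_itv|move=> i ni].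
  by rewrite -!tl_binary; exact: uv.
have -> : doubling u - doubling v = 2 * (u - v).
  have /= := uv 0%N isT; rewrite /binary/= /doubling !leNgt => /negb_inj ->.
  by case: ifP => _; ring.
by rewrite normrM ger0_norm// exprS -ler_pdivlMl.
Qed.

Lemma binary_first_diff u v : 0 <= u < 1 -> 0 <= v < 1 -> u != v ->
  exists2 n, binary u n != binary v n &
    forall i, (i < n)%N -> binary u i = binary v i.
Proof.
move=> u01 v01 uv.
have ex : exists n, binary u n != binary v n.
  apply: contrapT => H.
  have e i : binary u i = binary v i.
    by apply/eqP; apply: contrapT => /negP ne; apply: H; exists i.
  have : `|u - v| <= 0.
    have half : `|2^-1 : R| < 1 by rewrite ger0_norm//; lra.
    apply: (ler_cvg_to (cvg_cst `|u - v|) (cvg_expr half)).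
    by apply: nearW => n; apply: binary_dist => // i _; exact: e.
  by rewrite normr_le0 subr_eq0 (negbTE uv).
case: (ex_minnP ex) => n n_ne min; exists n => // i ni.
by apply/eqP; apply: contraTT ni => /min; rewrite -leqNgt.
Qed.

End BinaryDigits.

(** * Hoelder estimate for the block coding, and conclusion *)

(** If the digits first differ at index n, then |u - v| <= 2^-n, while the values differ by at least
    q^(n+1) >= (2^-(n+1))^4. The factor 2 absorbs the shift from n to n + 1. *)
Lemma expansion_value_weave_holder (R : realType) (b0 b1 s u v : R) :
  1 / 2 < b0 < 1 -> 1 / 2 < b1 -> b1 <= b0 ->
  b0 * (1 + 2 * b1 - b0 * b1) < 1 ->
  0 <= s <= 4^-1 -> 0 <= u < 1 -> 0 <= v < 1 ->
  `|u - v| <= 2 * `|expansion_value b0 b1 (weave (binary u)) -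
                    expansion_value b0 b1 (weave (binary v))| `^ s.
Proof.
move=> /andP[b0h b0_lt1] b1h b10 gap /andP[s0 s4] u01 v01.
have [->|uv] := eqVneq u v; first by rewrite subrr normr0 mulr_ge0// powR_ge0.
have b0_gt0 : 0 < b0 by lra.
have b1_gt0 : 0 < b1 by lra.
have [n n_ne n_min] := binary_first_diff u01 v01 uv.
apply: (le_trans (binary_dist u01 v01 n_min)).
have q16 : (2^-1 ^+ n.+1) ^+ 4 <= (b0 ^+ 2 * b1 ^+ 2) ^+ n.+1.
  rewrite exprAC; apply: lerXn2r; rewrite ?nnegrE ?exprn_ge0//.
    by rewrite mulr_ge0// exprn_ge0// ltW.
  rewrite (exprM 2^-1 2 2) expr2; apply: ler_pM => //;
    by apply: lerXn2r; rewrite ?nnegrE//; lra.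
have h := le_trans q16
  (expansion_value_weave_separated b0_gt0 b0_lt1 b1_gt0 b10 gap n_min n_ne).
have p0 : 0 < (2^-1 ^+ n.+1) ^+ 4 :> R by rewrite !exprn_gt0.
suff : 2^-1 ^+ n.+1 <= ((2^-1 ^+ n.+1) ^+ 4) `^ s :> R.
  move=> /le_trans le1; rewrite -ler_pdivrMl// -exprS; apply: le1.
  by apply: ge0_ler_powR => //; rewrite nnegrE// ltW.
(* The exponent 1/4 is the extreme case: for a base at most 1, a smaller exponent only increases the
   power. *)
have e : ((2^-1 ^+ n.+1) ^+ 4) `^ 4^-1 = 2^-1 ^+ n.+1 :> R.
  by rewrite -(powR_mulrn 4) ?exprn_ge0// -powRrM mulfV// powRr1 ?exprn_ge0.
rewrite -[leLHS]e; apply: ger_powR => //.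
by rewrite p0 !exprn_ile1 ?exprn_ge0//; lra.
Qed.

Theorem theorem5p1 (R : realType) (b0 b1 : R)
    (hb0 : 1 / 2 < b0 < 1) (hb1 : 1 / 2 < b1 < 1) (hb : b1 <= b0) :
  (b0 * (1 + b1) < 1 ->
     ([set: nat] #<= unique_expansion_set b0 b1)%card) /\
  (b0 * (1 + 2 * b1 - b0 * b1) < 1 ->
     ~ countable (unique_expansion_set b0 b1) /\
     (0 < hausdorff_dim (unique_expansion_set b0 b1))%E).
Proof.
have [b0_gt0 b1_gt0] : 0 < b0 /\ 0 < b1 by split; lra.
have [b0_lt1 b1h] : b0 < 1 /\ 1 / 2 < b1 by split; lra.
split=> [h|gap].
  pose f n := b0 ^+ n * alternating_value b0 b1.
  have f_inj : {in [set: nat] &, injective f}.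
    have b01_lt1 : b0 * b1 < 1 by rewrite mulr_ilt1 ?ltW//; lra.
    move=> m n _ _ /mulIf fmn; apply: (ieexprIn b0_gt0); first by rewrite lt_eqF.
    by apply: fmn; rewrite gt_eqF// divr_gt0 ?subr_gt0// mulr_gt0.
  have := inj_card_eq f_inj; rewrite card_eq_le => /andP[_ le1].
  apply: card_le_trans le1 (subset_card_le _) => _ [n _ <-].
  exact: unique_expansion_prefix_zeros.
pose F (u : R) : R := expansion_value b0 b1 (weave (binary u)).
have FA u : 0 <= u < 1 -> unique_expansion_set b0 b1 (F u).
  by move=> _; exact: unique_expansion_weave.
have F_holder s u v : 0 <= s <= 4^-1 -> 0 <= u < 1 -> 0 <= v < 1 ->
    `|u - v| <= 2 * `|F u - F v| `^ s.
  exact: expansion_value_weave_holder.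
split; last first.
  apply: (@lt_le_trans _ _ (4^-1 : R)%:E); first by rewrite lte_fin.
  exact: (hausdorff_dim_ge (f := F) (C := 2)).
(* Countability would pass to [0, 1[ through the injection [F], but [0, 1[ has Lebesgue measure
   1. *)
move=> /countable_injP[g g_inj].
have : countable `[0 : R, 1[%classic.
  apply/countable_injP; exists (g \o F) => u v.
  rewrite !inE/= !in_itv/= => u01 v01 /g_inj Fuv.
  have {}Fuv : F u = F v by apply: Fuv; rewrite inE; exact: FA.
  (* A nonzero exponent matters here, because 0 to the power 0 is 1. *)
  have := F_holder 4^-1 u v; rewrite Fuv subrr normr0 powR0 ?mulr0//.
  by rewrite normr_le0 subr_eq0 => H; apply/eqP/H => //; lra.
move=> /countable_lebesgue_measure0; rewrite lebesgue_measure_itv/=.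
by rewrite lte_fin ltr01 sube0 => /eqP; rewrite eqe oner_eq0.
Qed.
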